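(* Let $d$ be a positive integer, let $Q$ be an indexed set of polynomials, let $c$ be a cut-off function for $Q$, let $w$ be a positive integer, let $I$ be an ideal of $\mathbb{R}[x]$, and let $p$ be a polynomial of degree at most $2d$. If there is some $R\in\mathbb{R}_{\geq 0}$ such that $Q\vdash^{c,I}_{w,2}R\geq x^2$ for every variable $x$, then $$\sup\{r\in\mathbb{R} : Q\vdash^{c,I}_{w,2d}p\geq r\}=\inf\{E(p) : E\in\mathscr{E}^{c,I}_{w,2d}(Q)\}.$$ Moreover, if the set $\mathscr{E}^{c,I}_{w,2d}(Q)$ is non-empty, then there is a pseudo-expectation achieving the infimum; i.e., $\min\{E(p) : E\in\mathscr{E}^{c,I}_{w,2d}(Q)\}$ is well-defined.
   Context: $\mathbb{R}[x]$ is the ring of real polynomials in the $2n$ commuting variables $x_1,\ldots,x_n,\bar{x}_1,\ldots,\bar{x}_n$. $[n]=\{1,\ldots,n\}$. The usual convention $\deg(0)=-\infty$ is used. Suprema and infima are taken in the extended reals, with $\inf\emptyset=+\infty$. An indexed set of polynomials $Q=\{q_1,\ldots,q_\ell,p_1,\ldots,p_m\}\subseteq\mathbb{R}[x]$ is interpreted as the constraints $q_1\geq 0,\ldots,q_\ell\geq 0$, $p_1=0,\ldots,p_m=0$. For an ideal $I$ of $\mathbb{R}[x]$, a PS proof mod $I$ of $p\geq 0$ from $Q$ is an identity $$p\equiv s_\emptyset+\sum_{J\in\mathscr{J}}s_J\prod_{j\in J}q_j+\sum_{j\in[m]}t_jp_j\mod I,$$ where $\mathscr{J}$ is a collection of non-empty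 subsets of $[\ell]$, each $s_J$ is a sum of squares of polynomials, and each $t_j$ is an arbitrary polynomial. It has product-width at most $w$ if each $J\in\mathscr{J}$ has cardinality at most $w$. A cut-off function for $Q$ is a function $c$ from the disjoint union of the power set of $[\ell]$ and $[m]$ to $\mathbb{N}$ with $c(J)\geq\sum_{j\in J}\deg(q_j)$ for each $J\subseteq[\ell]$ and $c(j)\geq\deg(p_j)$ for each $j\in[m]$. The proof has degree mod $c$ at most $d$ if $\deg(p)\leq d$, $\deg(s_\emptyset)\leq d$, $\deg(s_J)\leq d-c(J)$ for each $J\in\mathscr{J}$, and $\deg(t_j)\leq d-c(j)$ for each $j\in[m]$. $\mathrm{PS}^{c,I}_{w,d}(Q)$ is the convex cone of all polynomials $p$ such that $p\geq 0$ has a PS proof mod $I$ from $Q$ of degree mod $c$ at most $d$ and product-width at most $w$. $Q\vdash^{c,I}_{w,d}p\geq q$ means $p-q\in\mathrm{PS}^{c,I}_{w,d}(Q)$. $\mathscr{E}^{c,I}_{w,2d}(Q)$ is the set of pseudo-expectations: linear functionals $E$ from the space of polynomials of degree at most $2d$ to $\mathbb{R}$ such that $E(1)=1$ and $E(q)\geq 0$ for all $q\in\mathrm{PS}^{c,I}_{w,2d}(Q)$. *)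

(* Defs.v *)
From HB Require Import structures.
From mathcomp Require Import all_boot all_order all_algebra.
From mathcomp Require Import mpoly.
From mathcomp Require Import boolp classical_sets reals ereal.
Set Implicit Arguments.
Unset Strict Implicit.
Unset Printing Implicit Defensive.
Import Order.TTheory GRing.Theory Num.Theory.
Local Open Scope ring_scope.

(* The definitions are given for {mpoly R[N]} with N arbitrary; the ring
   R[x_1, .., x_n, \bar x_1, .., \bar x_n] is {mpoly R[n + n]}, in which
   x_i is 'X_(lshift n i) and \bar x_i is 'X_(rshift n i). *)

Section Degree.
Variables (R : realType) (N : nat).

(* Values are extended integers so that deg 0 = -oo and so that the bounds
   d - c(J) below are genuine (possibly negative) integers; a negative bound
   forces the polynomial to be 0. *)
Definition deg (p : {mpoly R[N]}) : \bar int :=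
  if p == 0 then -oo%E else ((msize p).-1%:Z)%:E.

Lemma deg_leE (k : nat) (p : {mpoly R[N]}) :
  (deg p <= (k%:Z)%:E)%E = (msize p <= k.+1)%N.
Proof.
rewrite /deg; have [->|p0] := eqVneq p 0; first by rewrite msize0 leNye.
rewrite lee_fin lez_nat.
by move: p0; rewrite -msize_poly_eq0; case: (msize p).
Qed.

Definition deg_le (k : nat) : {pred {mpoly R[N]}} :=
  fun p => (deg p <= (k%:Z)%:E)%E.

Lemma deg_le_submod_closed (k : nat) : submod_closed (deg_le k).
Proof.
split=> [|a p q]; rewrite !unfold_in !deg_leE ?msize0 // => hp hq.
apply: (leq_trans (msizeD_le _ _)); rewrite geq_max hq andbT.
exact: (leq_trans (msizeZ_le _ _)).
Qed.

HB.instance Definition _ (k : nat) :=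
  GRing.isSubmodClosed.Build R {mpoly R[N]} (deg_le k)
    (deg_le_submod_closed k).

Record polyle (k : nat) := PolyLe {
  polyle_val :> {mpoly R[N]};
  polyle_deg : deg_le k polyle_val
}.

HB.instance Definition _ (k : nat) := [isSub for @polyle_val k].
HB.instance Definition _ (k : nat) := [Choice of polyle k by <:].
HB.instance Definition _ (k : nat) :=
  [SubChoice_isSubLmodule of polyle k by <:].

Lemma deg_le1 (k : nat) : deg_le k 1.
Proof. by rewrite /deg_le deg_leE msize1. Qed.

Definition polyle1 (k : nat) : polyle k := PolyLe (deg_le1 k).

End Degree.

Section Proofs.
Variables (R : realType) (N : nat).
Local Notation P := {mpoly R[N]}.

Record constraints := Constraints {
  nineq : nat;
  neq : nat;
  ineq : 'I_nineq -> P;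
  equ : 'I_neq -> P
}.

(* Ideals need not be proper, and membership need not be decidable. *)
Record is_ideal (I : set P) : Prop := IsIdeal {
  ideal0 : I 0;
  idealD : forall a b, I a -> I b -> I (a + b);
  idealM : forall a b, I b -> I (a * b)
}.

Definition congr_mod (I : set P) (a b : P) : Prop := I (a - b).

Definition is_sos (s : P) : Prop :=
  exists fs : seq P, s = \sum_(f <- fs) f ^+ 2.

Definition cutoff (Q : constraints) (c : {set 'I_(nineq Q)} + 'I_(neq Q) -> nat)
  : Prop :=
  (forall J : {set 'I_(nineq Q)},
      (\sum_(j in J) deg (ineq j) <= ((c (inl J))%:Z)%:E)%E) /\
  (forall j : 'I_(neq Q), (deg (equ j) <= ((c (inr j))%:Z)%:E)%E).

(* The values of ps_s outside ps_J are irrelevant. *)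
Record ps_data (Q : constraints) := PSData {
  ps_J : {set {set 'I_(nineq Q)}};
  ps_s0 : P;
  ps_s : {set 'I_(nineq Q)} -> P;
  ps_t : 'I_(neq Q) -> P
}.

Definition ps_proof (Q : constraints) (I : set P) (p : P) (pi : ps_data Q)
  : Prop :=
  [/\ finset.set0 \notin ps_J pi,
      is_sos (ps_s0 pi),
      (forall J, J \in ps_J pi -> is_sos (ps_s pi J)) &
      congr_mod I p
        (ps_s0 pi + \sum_(J in ps_J pi) ps_s pi J * \prod_(j in J) ineq j
         + \sum_j ps_t pi j * equ j)].

Definition product_width_le (Q : constraints) (w : nat) (pi : ps_data Q)
  : Prop := forall J, J \in ps_J pi -> (#|J| <= w)%N.

Definition degree_mod_le (Q : constraints)
    (c : {set 'I_(nineq Q)} + 'I_(neq Q) -> nat) (d : nat) (p : P)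
    (pi : ps_data Q) : Prop :=
  [/\ (deg p <= (d%:Z)%:E)%E,
      (deg (ps_s0 pi) <= (d%:Z)%:E)%E,
      (forall J, J \in ps_J pi ->
         (deg (ps_s pi J) <= (d%:Z - (c (inl J))%:Z)%:E)%E) &
      (forall j, (deg (ps_t pi j) <= (d%:Z - (c (inr j))%:Z)%:E)%E)].

Definition PS (Q : constraints) (c : {set 'I_(nineq Q)} + 'I_(neq Q) -> nat)
    (I : set P) (w d : nat) : set P :=
  [set p | exists pi : ps_data Q,
     [/\ ps_proof I p pi, degree_mod_le c d p pi & product_width_le w pi]].

Definition proves_ge (Q : constraints)
    (c : {set 'I_(nineq Q)} + 'I_(neq Q) -> nat)
    (I : set P) (w d : nat) (p q : P) : Prop := PS c I w d (p - q).

(* Indexed by k = 2d, the common degree bound. *)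
Definition pseudo_expectations (Q : constraints)
    (c : {set 'I_(nineq Q)} + 'I_(neq Q) -> nat)
    (I : set P) (w k : nat) : set {scalar polyle R N k} :=
  [set E | E (polyle1 R N k) = 1 /\
           forall q : polyle R N k, PS c I w k q -> 0 <= E q].

End Proofs.

Arguments pseudo_expectations {R N Q} c I w%_N k%_N.
Arguments PS {R N Q} c I w%_N d%_N.
Arguments proves_ge {R N Q} c I w%_N d%_N p q.

(* Main.v *)
Require Import Defs.
From HB Require Import structures.
From mathcomp Require Import all_boot all_order all_algebra.
From mathcomp Require Import mpoly ring lra zify.
From mathcomp Require Import boolp classical_sets reals ereal.
Set Implicit Arguments.
Unset Strict Implicit.
Unset Printing Implicit Defensive.
Import Order.TTheory GRing.Theory Num.Theory.
Local Open Scope classical_set_scope.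
Local Open Scope ring_scope.

(* The cone of provable polynomials of degree at most 2d has 1 as an order unit:
   multiplying the proofs of B - x^2 >= 0 by squares of monomials gives
   B^|m| - m^2 in the cone whenever |m| <= d, and a monomial of degree at most
   2d is a product m1 m2 of two such monomials, bounded through
   2 m1 m2 <= m1^2 + m2^2. Strong duality then holds in any real vector space
   with a convex cone C and an order unit u: if -u is not in C, let s be the
   supremum of the r with p - r u in C; the cone generated by C and s u - p still
   avoids -u, hence lies in a maximal cone M avoiding -u. Such an M satisfies M union -M = V, so every v
   has a unique cut point t separating {r | v - r u in M} from
   {r | r u - v in M}, and v |-> t is a linear functional attaining s at p. No
   closedness of the cone is needed. *)

(** * Convex cones with an order unit *)

Record is_cone (R : realType) (V : lmodType R) (C : set V) : Prop := IsCone {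
  cone0 : C 0;
  coneD : forall v w, C v -> C w -> C (v + w);
  coneZ : forall (a : R) v, 0 <= a -> C v -> C (a *: v)
}.

(** For a cone [C] this is the smallest cone containing both [C] and [v]. *)
Definition adjoin (R : realType) (V : lmodType R) (C : set V) (v : V) : set V :=
  [set x + a *: v | x in C & a in [set a : R | 0 <= a]].

(** The normalised positive functionals of an ordered vector space. For the cone of provable
    polynomials and [u] the constant 1, this unfolds to [pseudo_expectations]. *)
Definition states (R : realType) (V : lmodType R) (C : set V) (u : V) :
  set {scalar V} := [set E | E u = 1 /\ forall v, C v -> 0 <= E v].

Section OrderUnit.
Variables (R : realType) (V : lmodType R) (u : V).

Lemma sub_adjoin (C : set V) v : C `<=` adjoin C v.
Proof.
by move=> x Cx; exists x => //; exists 0; rewrite /= ?scale0r ?addr0.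
Qed.

Lemma mem_adjoin (C : set V) v : is_cone C -> adjoin C v v.
Proof.
move=> hC; exists 0; first exact: cone0.
by exists 1; rewrite /= ?ler01 // scale1r add0r.
Qed.

Lemma adjoin_cone (C : set V) v : is_cone C -> is_cone (adjoin C v).
Proof.
move=> hC; split; first by apply: sub_adjoin; apply: cone0.
- move=> _ _ [x Cx [a /= a0 <-]] [y Cy [b /= b0 <-]].
  exists (x + y); first exact: coneD.
  by exists (a + b); rewrite /= ?addr_ge0 // scalerDl addrACA.
- move=> c _ c0 [x Cx [a /= a0 <-]].
  exists (c *: x); first exact: coneZ.
  by exists (c * a); rewrite /= ?mulr_ge0 // scalerDr scalerA.
Qed.

Lemma cone_rescale (C : set V) (a : R) v :
  is_cone C -> 0 < a -> C (a *: v) -> C v.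
Proof.
move=> hC a0 Cv; rewrite -[v]scale1r -(mulVf (lt0r_neq0 a0)) -scalerA.
by apply: coneZ => //; rewrite invr_ge0 ltW.
Qed.

Lemma cone_unit_ge0 (C : set V) (r : R) :
  is_cone C -> ~ C (- u) -> C (r *: u) -> 0 <= r.
Proof.
move=> hC Cu Cr; rewrite leNgt; apply/negP => r0; apply: Cu.
by apply: (@cone_rescale _ (- r)); rewrite ?oppr_gt0 // scalerN scaleNr opprK.
Qed.

(** Zorn's lemma gives a maximal cone avoiding [- u]. If it missed both [v] and [- v], adjoining
    either one would produce [- u], and the two expressions combine to put [- u] in the cone
    itself. *)
Lemma maximal_cone (C : set V) : is_cone C -> ~ C (- u) ->
  exists M : set V, [/\ is_cone M, C `<=` M, ~ M (- u) &
    forall v, M v \/ M (- v)].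
Proof.
move=> hC Cu.
(* Stating the property for the union with [C] makes it hold for the empty chain, whose union is
   empty. *)
pose P A := is_cone (C `|` A) /\ ~ (C `|` A) (- u).
have [F FP Ftot|A [[hA Au] Amax]] := @Zorn_bigcup V P.
  (* As F is a chain, two elements of the union lie in a common member. *)
  have key v w : (C `|` \bigcup_(X in F) X) v -> (C `|` \bigcup_(X in F) X) w ->
      (C v /\ C w) \/ exists2 X, F X & (C `|` X) v /\ (C `|` X) w.
    case=> [Cv|[X FX Xv]] [Cw|[Y FY Yw]].
    - by left.
    - by right; exists Y => //; split; [left|right].
    - by right; exists X => //; split; [right|left].
    - case: (Ftot X Y FX FY) => XY; right; [exists Y|exists X] => //.
      + by split; right=> //; apply: XY.
      + by split; right=> //; apply: XY.
  have FC X : F X -> C `|` X `<=` C `|` \bigcup_(X in F) X.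
    by move=> FX v [Cv|Xv]; [left|right; exists X].
  split; first split; first by left; apply: cone0.
  - move=> v w Fv Fw; case: (key v w Fv Fw) => [[Cv Cw]|[X FX [Xv Xw]]].
      by left; apply: coneD.
    by apply: (FC X FX); apply: (coneD (FP X FX).1).
  - move=> a v a0 Fv; case: (key v v Fv Fv) => [[Cv _]|[X FX [Xv _]]].
      by left; apply: coneZ.
    by apply: (FC X FX); apply: (coneZ (FP X FX).1).
  - by case=> // -[X FX Xu]; apply: (FP X FX).2; right.
exists (C `|` A); split=> //.
(* Adjoining a missing [v] enlarges the cone strictly, so by maximality [- u] must appear. *)
have push v : ~ (C `|` A) v ->
    exists2 a, 0 <= a & exists2 x, (C `|` A) x & - u = x + a *: v.
  move=> Av; apply: contrapT => no.
  pose B := adjoin (C `|` A) v.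
  have CB : C `|` B = B.
    by apply/seteqP; split=> [x [Cx|//]|x]; [apply: sub_adjoin; left|right].
  apply: (Amax B); last first.
    split; rewrite CB; first exact: adjoin_cone.
    by case=> x Ax [a /= a0 xa]; apply: no; exists a => //; exists x.
  split; first by move=> x Ax; apply: sub_adjoin; right.
  by move=> BA; apply: Av; right; apply: BA; apply: mem_adjoin.
move=> v; apply: contrapT => /not_orP[Av ANv].
have [a a0 [x Ax xE]] := push _ Av.
have [b b0 [y Ay yE]] := push _ ANv.
have [a00|a_gt0] := eqVneq a 0.
  by apply: Au; rewrite xE a00 scale0r addr0.
have ab : 0 < a + b by rewrite ltr_pwDl // lt0r a_gt0.
apply: Au; apply: (cone_rescale hA ab).
(* From [- u = x + a *: v] and [- u = y - b *: v], the weights [b] and [a] cancel [v]. *)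
suff -> : (a + b) *: - u = a *: y + b *: x.
  by apply: (coneD hA); apply: (coneZ hA).
rewrite scalerDl {1}yE xE !scalerDr !scalerA scalerN (mulrC b a).
by rewrite addrACA addNr addr0.
Qed.

(** The functional sends [v] to its Dedekind cut. Cuts add and scale, and uniqueness of the cut
    point turns this into linearity. *)
Lemma state_of_maximal (M : set V) : is_cone M -> ~ M (- u) ->
    (forall v, M v \/ M (- v)) -> (forall v, exists r : R, M (r *: u - v)) ->
  states M u !=set0.
Proof.
move=> hM Mu Mtot Munit.
have Mu1 : M u by case: (Mtot u).
have Mneg r : M (r *: u) -> 0 <= r by apply: cone_unit_ge0.
have Mtri (r s : R) v : M (s *: u - v) -> M (v - r *: u) -> r <= s.
  move=> Ms Mr; rewrite -subr_ge0; apply: Mneg.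
  by have := coneD hM Ms Mr; rewrite addrA subrK -scalerBl.
have Mle (r s : R) v : s <= r -> M (v - r *: u) -> M (v - s *: u).
  move=> sr Mr; rewrite -[v](subrK (r *: u)) -addrA -scalerBl.
  by apply: (coneD hM) => //; apply: (coneZ hM); rewrite ?subr_ge0.
(* Both inequalities are strict: [M] need not be closed, so nothing is claimed at [t] itself. *)
pose cut v (t : R) := (forall r, r < t -> M (v - r *: u)) /\
                      (forall r, t < r -> M (r *: u - v)).
have cut_ex v : exists t, cut v t.
  pose S := [set r : R | M (v - r *: u)].
  have hS : has_sup S.
    split.
      have [r Mr] := Munit (- v); exists (- r).
      by rewrite /S /= scaleNr opprK addrC -[v]opprK.
    by have [s Ms] := Munit v; exists s => r /= Mr; apply: (Mtri r s v).
  exists (sup S); split=> r.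
    rewrite -subr_gt0 => r0; have [s Ss] := sup_adherent r0 hS.
    by rewrite opprB addrC subrK => /ltW rs; apply: (Mle s).
  (* Above [sup S] the element [v - r *: u] is not in [M], so totality supplies its opposite. *)
  move=> Sr; case: (Mtot (r *: u - v)) => //; rewrite opprB => Mr.
  by have := sup_upper_bound hS Mr; rewrite leNgt Sr.
have cut_le v s t : cut v s -> cut v t -> s <= t.
  move=> [s1 _] [_ t2]; rewrite leNgt; apply/negP => ts.
  (* Two distinct points between [t] and [s] are taken, since [Mtri] yields only a weak
     inequality. *)
  have [ta as_] := midf_lt ts; set m := _ / _ in ta as_.
  have [mb bs] := midf_lt as_.
  by have := Mtri _ _ _ (t2 _ ta) (s1 _ bs); rewrite leNgt mb.
have cut_uniq v s t : cut v s -> cut v t -> s = t.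
  by move=> vs vt; apply/eqP; rewrite eq_le !(cut_le v).
have cutD v w s t : cut v s -> cut w t -> cut (v + w) (s + t).
  move=> [v1 v2] [w1 w2]; split=> r rst.
    (* Half of the gap goes to each summand, leaving each strictly below its own cut. *)
    pose e := (s + t - r) / 2.
    have -> : r = (s - e) + (t - e) by rewrite /e; field.
    rewrite scalerDl opprD addrACA; apply: (coneD hM); [apply: v1|apply: w1].
      by rewrite /e; lra.
    by rewrite /e; lra.
  pose e := (r - s - t) / 2.
  have -> : r = (s + e) + (t + e) by rewrite /e; field.
  rewrite scalerDl opprD addrACA; apply: (coneD hM); [apply: v2|apply: w2].
    by rewrite /e; lra.
  by rewrite /e; lra.
have cutN v s : cut v s -> cut (- v) (- s).
  move=> [v1 v2]; split=> r rs.
    by rewrite addrC -scaleNr; apply: v2; rewrite ltrNr.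
  by rewrite opprK -[r]opprK scaleNr addrC; apply: v1; rewrite ltrNl.
have cut0 : cut 0 0.
  split=> r r0; rewrite ?sub0r ?subr0 -?scaleNr.
    by apply: (coneZ hM) => //; rewrite oppr_ge0 ltW.
  by apply: (coneZ hM) => //; rewrite ltW.
have cutZp (a : R) v s : 0 < a -> cut v s -> cut (a *: v) (a * s).
  move=> a0 [v1 v2]; split=> r rs; rewrite -(mulVKf (lt0r_neq0 a0) r).
    rewrite -scalerA -scalerBr; apply: (coneZ hM); first exact: ltW.
    by apply: v1; rewrite mulrC ltr_pdivrMr // mulrC.
  rewrite -scalerA -scalerBr; apply: (coneZ hM); first exact: ltW.
  by apply: v2; rewrite mulrC ltr_pdivlMr // mulrC.
have cutZ (a : R) v s : cut v s -> cut (a *: v) (a * s).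
  move=> vs; have [a0|a0|->] := ltgtP a 0; last by rewrite scale0r mul0r.
    rewrite -[a]opprK scaleNr mulNr; apply: cutN; apply: cutZp => //.
    by rewrite oppr_gt0.
  exact: cutZp.
have [e eP] := choice cut_ex.
have e_lin : linear_for *%R e.
  by move=> a v w; apply: (cut_uniq (a *: v + w)) => //; apply: cutD => //;
    apply: cutZ.
pose E : {scalar V} := HB.pack e (GRing.isLinear.Build R V R *%R e e_lin).
exists E; split=> [|v Mv].
  apply: (cut_uniq u) => //; split=> r r1.
    by rewrite -{1}[u]scale1r -scalerBl; apply: (coneZ hM); rewrite // subr_ge0 ltW.
  by rewrite -{2}[u]scale1r -scalerBl; apply: (coneZ hM); rewrite // subr_ge0 ltW.
(* If [e v < r < 0], then [r *: u - v] and [v] both lie in [M], hence so does [r *: u], forcing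
   [0 <= r]. *)
rewrite leNgt; apply/negP => Ev.
have [er r0] := midf_lt Ev.
have := coneD hM ((eP v).2 _ er) Mv; rewrite subrK => /Mneg.
by rewrite leNgt r0.
Qed.

Lemma order_unit_state (C : set V) : is_cone C -> ~ C (- u) ->
  (forall v, exists r : R, C (r *: u - v)) -> states C u !=set0.
Proof.
move=> hC Cu Cunit; have [M [hM CM Mu Mtot]] := maximal_cone hC Cu.
have [|E [Eu EM]] := state_of_maximal hM Mu Mtot.
  by move=> v; have [r Cr] := Cunit v; exists r; apply: CM.
by exists E; split=> // v /CM; apply: EM.
Qed.

Lemma order_unit_duality (C : set V) (p : V) : is_cone C ->
    (forall v, exists r : R, C (r *: u - v)) ->
  ereal_sup [set r%:E | r in [set r : R | C (p - r *: u)]]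
  = ereal_inf [set (E p)%:E | E in states C u]
  /\ (states C u !=set0 -> exists2 E, states C u E &
       (E p)%:E = ereal_inf [set (E' p)%:E | E' in states C u]).
Proof.
move=> hC Cunit.
set D := [set r%:E | r in _]; set T := [set (E p)%:E | E in states C u].
have weak r E : C (p - r *: u) -> states C u E -> r <= E p.
  by move=> Cr [Eu EC]; have := EC _ Cr; rewrite linearB linearZ /= Eu mulr1 subr_ge0.
(* If [- u] is in [C] there are no states and both sides are [+oo]. *)
have [Cu|Cu] := pselect (C (- u)).
  have noE E : ~ states C u E.
    by case=> Eu /(_ _ Cu); rewrite linearN /= Eu leNgt ltrN10.
  split; last by case=> E /noE.
  have -> : T = set0 by apply/seteqP; split=> // y [E /noE[]].
  rewrite ereal_inf0; apply: eq_infty => r; have [t Ct] := Cunit (- p).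
  (* The bound by [r] makes the supremum infinite; the bound by [- t] makes the coefficient [m + t]
     of [- u] non-negative. *)
  pose m := Num.max r (- t).
  apply: (@le_trans _ _ m%:E); first by rewrite lee_fin le_max lexx.
  apply: ereal_sup_ubound; exists m => //=.
  have -> : p - m *: u = (t *: u - - p) + (m + t) *: - u.
    by rewrite opprK scalerN scalerDl opprD [t *: u + p]addrC addrACA subrr addr0.
  apply: (coneD hC) => //; apply: (coneZ hC) => //.
  by rewrite -[t]opprK subr_ge0 le_max lexx orbT.
have Cneg r : C (r *: u) -> 0 <= r by apply: cone_unit_ge0.
pose S := [set r : R | C (p - r *: u)].
have S0 : S !=set0.
  have [r Cr] := Cunit (- p); exists (- r).
  by rewrite /S /= scaleNr opprK addrC -[p]opprK.
have Sub : has_ubound S.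
  have [t Ct] := Cunit p; exists t => r /= Sr; rewrite -subr_ge0; apply: Cneg.
  by have := coneD hC Ct Sr; rewrite addrA subrK -scalerBl.
(* Positivity on [sup S *: u - p] forces [E p <= sup S]; weak duality gives the converse. *)
have [|||E [Eu EC]] := @order_unit_state (adjoin C (sup S *: u - p)).
- exact: adjoin_cone.
- case=> x Cx [a /= a0 xE].
  have [a00|a_neq0] := eqVneq a 0.
    by move: xE; rewrite a00 scale0r addr0 => xu; apply: Cu; rewrite -xu.
  have a_gt0 : 0 < a by rewrite lt0r a_neq0.
  (* Dividing [- u = x + a *: (sup S *: u - p)] by [a] shows that [p - (sup S + a^-1) *: u] is
     [a^-1 *: x], beyond the supremum. *)
  suff Sa : S (sup S + a^-1).
    by have := ub_le_sup Sub Sa; rewrite leNgt ltrDl invr_gt0 a_gt0.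
  rewrite /S /=; apply: (cone_rescale hC a_gt0).
  rewrite scalerDl opprD addrA scalerBr scalerA mulfV // scale1r -xE.
  by rewrite -opprB scalerN addrC addrK.
- by move=> v; have [r Cr] := Cunit v; exists r; apply: sub_adjoin.
have EC' : states C u E by split=> // v Cv; apply: EC; apply: sub_adjoin.
have Ep : E p = sup S.
  apply/eqP; rewrite eq_le; apply/andP; split.
    have := EC _ (mem_adjoin (sup S *: u - p) hC).
    by rewrite linearB linearZ /= Eu mulr1 subr_ge0.
  by apply: (ge_sup S0) => r Sr; apply: weak.
have TE : ereal_inf T = (E p)%:E.
  apply/eqP; rewrite eq_le; apply/andP; split.
    by apply: ereal_inf_lbound; exists E.
  apply: le_ereal_inf_tmp => _ [E' E'C <-]; rewrite lee_fin Ep.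
  by apply: (ge_sup S0) => r Sr; apply: weak.
by rewrite TE; split=> [|_]; [rewrite Ep /D ereal_sup_EFin | exists E].
Qed.

End OrderUnit.

(** * The cone of provable polynomials *)

Section DegreeBounds.
Variables (R : realType) (N : nat).
Implicit Types p q : {mpoly R[N]}.

Lemma deg_neq0 p : p != 0 -> deg p = ((msize p).-1%:Z)%:E.
Proof. by rewrite /deg => /negPf ->. Qed.

Lemma deg_le0 (x : \bar int) : (deg (0 : {mpoly R[N]}) <= x)%E.
Proof. by rewrite /deg eqxx leNye. Qed.

Lemma deg_leD p q (x : \bar int) :
  (deg p <= x -> deg q <= x -> deg (p + q) <= x)%E.
Proof.
have [->|p0] := eqVneq p 0; first by rewrite add0r.
have [->|q0] := eqVneq q 0; first by rewrite addr0.
have [->|pq0] := eqVneq (p + q) 0; first by move=> _ _; apply: deg_le0.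
rewrite !deg_neq0 // => hp hq.
have : ((msize (p + q)).-1 <= maxn (msize p).-1 (msize q).-1)%N.
  by have := msizeD_le p q; lia.
rewrite leq_max => /orP[h|h]; [apply: le_trans hp|apply: le_trans hq];
  by rewrite lee_fin lez_nat.
Qed.

(** The bounds are integers because d - c(J) can be negative, in which case the polynomial is 0. *)
Lemma deg_leM p q (a b : int) :
  (deg p <= a%:E -> deg q <= b%:E -> deg (p * q) <= (a + b)%:E)%E.
Proof.
have [->|p0] := eqVneq p 0; first by move=> _ _; rewrite mul0r deg_le0.
have [->|q0] := eqVneq q 0; first by move=> _ _; rewrite mulr0 deg_le0.
have pq0 : p * q != 0 by rewrite mulf_neq0.
rewrite !deg_neq0 // !lee_fin msizeM //.
move: p0 q0; rewrite -!msize_poly_eq0.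
case: (msize p) (msize q) => [//|k] [//|l] _ _; rewrite addSn addnS PoszD.
exact: lerD.
Qed.

Lemma deg_leX2 p (k : nat) :
  (deg p <= k%:Z%:E -> deg (p ^+ 2) <= ((2 * k)%N%:Z)%:E)%E.
Proof. by move=> hp; rewrite mul2n -addnn PoszD expr2 deg_leM. Qed.

Lemma deg_leC (a : R) (k : nat) : (deg (a%:MP : {mpoly R[N]}) <= k%:Z%:E)%E.
Proof. by rewrite deg_leE msizeC; case: eqP. Qed.

Lemma deg_leX (m : 'X_{1..N}) (k : nat) :
  (mdeg m <= k)%N -> (deg ('X_[m] : {mpoly R[N]}) <= k%:Z%:E)%E.
Proof. by rewrite deg_leE msizeX. Qed.

End DegreeBounds.

(** * Closure of the provable polynomials under sums, scaling and multiplication by squares *)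

Section Cone.
Variables (R : realType) (N : nat) (Q : constraints R N).
Variables (c : {set 'I_(nineq Q)} + 'I_(neq Q) -> nat) (I : set {mpoly R[N]}).
Variable (w : nat).
Hypothesis hI : is_ideal I.
Implicit Types p q f : {mpoly R[N]}.

Lemma sosD p q : is_sos p -> is_sos q -> is_sos (p + q).
Proof. by move=> [fs ->] [gs ->]; exists (fs ++ gs); rewrite big_cat. Qed.

Lemma sosMsqr p f : is_sos p -> is_sos (p * f ^+ 2).
Proof.
move=> [fs ->]; exists [seq g * f | g <- fs].
by rewrite big_map mulr_suml; apply: eq_bigr => g _; rewrite exprMn.
Qed.

Lemma sos0 : is_sos (0 : {mpoly R[N]}).
Proof. by exists [::]; rewrite big_nil. Qed.

Lemma congr_modD a a' b b' :
  congr_mod I a b -> congr_mod I a' b' -> congr_mod I (a + a') (b + b').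
Proof. by rewrite /congr_mod opprD addrACA; apply: idealD. Qed.

Lemma congr_modMr a b e : congr_mod I a b -> congr_mod I (a * e) (b * e).
Proof. by rewrite /congr_mod -mulrBl mulrC; apply: idealM. Qed.

Lemma PS_sqr (k : nat) f : (deg f <= k%:Z%:E)%E -> PS c I w (2 * k) (f ^+ 2).
Proof.
move=> hf; have hf2 := deg_leX2 hf.
exists (PSData finset.set0 (f ^+ 2) (fun=> 0) (fun=> 0)).
split; [split=> /=|split=> /=|].
- by rewrite finset.inE.
- by exists [:: f]; rewrite big_seq1.
- by move=> J; rewrite finset.inE.
- rewrite /congr_mod big_set0 big1; first by rewrite !addr0 subrr; apply: ideal0.
  by move=> j _; rewrite mul0r.
- by [].
- by [].
- by move=> J; rewrite finset.inE.
- by move=> j; apply: deg_le0.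
- by move=> J; rewrite finset.inE.
Qed.

Lemma PS_add (k : nat) p q : PS c I w k p -> PS c I w k q -> PS c I w k (p + q).
Proof.
move=> [[J1 s01 s1 t1] [[/= J10 h01 hs1 e1] [/= hp d01 d1 dt1] w1]].
move=> [[J2 s02 s2 t2] [[/= J20 h02 hs2 e2] [/= hq d02 d2 dt2] w2]].
(* Values outside the collection are unconstrained, so they are reset to 0 before passing to the
   union. *)
pose s1' J := if J \in J1 then s1 J else 0.
pose s2' J := if J \in J2 then s2 J else 0.
exists (PSData (J1 :|: J2)%SET (s01 + s02) (fun J => s1' J + s2' J)
               (fun j => t1 j + t2 j)).
split; [split=> /=|split=> /=|].
- by rewrite finset.in_setU negb_or J10 J20.
- exact: sosD.
- move=> J _; apply: sosD; rewrite /s1' /s2'; case: ifP => //.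
  + exact: hs1.
  + by move=> _; apply: sos0.
  + exact: hs2.
  + by move=> _; apply: sos0.
- have E1 : \sum_(J in J1) s1 J * \prod_(j in J) ineq j
      = \sum_(J in (J1 :|: J2)%SET) s1' J * \prod_(j in J) ineq j.
    rewrite big_mkcond [RHS]big_mkcond; apply: eq_bigr => J _.
    by rewrite finset.in_setU /s1'; case: (J \in J1) => //=; case: ifP;
      rewrite ?mul0r.
  have E2 : \sum_(J in J2) s2 J * \prod_(j in J) ineq j
      = \sum_(J in (J1 :|: J2)%SET) s2' J * \prod_(j in J) ineq j.
    rewrite big_mkcond [RHS]big_mkcond; apply: eq_bigr => J _.
    by rewrite finset.in_setU orbC /s2'; case: (J \in J2) => //=; case: ifP;
      rewrite ?mul0r.
  under eq_bigr do rewrite mulrDl.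
  under [X in _ + _ + X]eq_bigr do rewrite mulrDl.
  rewrite !big_split /= -E1 -E2.
  have -> : forall a b e a' b' e' : {mpoly R[N]},
    a + a' + (b + b') + (e + e') = a + b + e + (a' + b' + e') by move=> *; ring.
  exact: congr_modD.
- exact: deg_leD.
- exact: deg_leD.
- move=> J _; apply: deg_leD; rewrite /s1' /s2'; case: ifP => [|_].
  + exact: d1.
  + exact: deg_le0.
  + exact: d2.
  + exact: deg_le0.
- by move=> j; apply: deg_leD.
- by move=> J; rewrite finset.in_setU => /orP[/w1|/w2].
Qed.

(** The square is absorbed into the multipliers; the products of constraints, and hence the
    product-width, do not change. *)
Lemma PS_mulsqr (k e : nat) p f : (deg f <= e%:Z%:E)%E ->
  PS c I w k p -> PS c I w (k + 2 * e) (p * f ^+ 2).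
Proof.
move=> /deg_leX2 hf [[J s0 s t] [[/= J0 h0 hs he] [/= hp d0 d dt] wJ]].
exists (PSData J (s0 * f ^+ 2) (fun J => s J * f ^+ 2) (fun j => t j * f ^+ 2)).
split; [split=> //=|split=> //=|by []].
- exact: sosMsqr.
- by move=> K KJ; apply: sosMsqr; apply: hs.
- have -> : s0 * f ^+ 2 + \sum_(K in J) s K * f ^+ 2 * \prod_(j in K) ineq j
      + \sum_j t j * f ^+ 2 * equ j
    = (s0 + \sum_(K in J) s K * \prod_(j in K) ineq j + \sum_j t j * equ j) * f ^+ 2.
    rewrite !mulrDl !mulr_suml; congr (_ + _ + _);
      by apply: eq_bigr => i _; rewrite mulrAC.
  exact: congr_modMr.
- by rewrite PoszD; apply: deg_leM.
- by rewrite PoszD; apply: deg_leM.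
- by move=> K KJ; rewrite PoszD addrAC; apply: deg_leM => //; apply: d.
- by move=> j; rewrite PoszD addrAC; apply: deg_leM => //; apply: dt.
Qed.

Lemma PS_mono (k l : nat) p : (k <= l)%N -> PS c I w k p -> PS c I w l p.
Proof.
move=> kl [pi [hpi [hp d0 d dt] wpi]]; exists pi; split=> //.
split; first by apply: le_trans hp _; rewrite lee_fin.
- by apply: le_trans d0 _; rewrite lee_fin.
- by move=> J KJ; apply: le_trans (d _ KJ) _; rewrite lee_fin lerD2r.
- by move=> j; apply: le_trans (dt j) _; rewrite lee_fin lerD2r.
Qed.

Lemma PS_scale (k : nat) (a : R) p : 0 <= a -> PS c I w k p -> PS c I w k (a *: p).
Proof.
move=> a0 hp; rewrite -(sqr_sqrtr a0) -mul_mpolyC mulrC rmorphXn /= -[k]addn0.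
have := PS_mulsqr (deg_leC N (Num.sqrt a) 0) hp.
by rewrite muln0.
Qed.

Lemma PS_const (k : nat) (a : R) : 0 <= a -> PS c I w k a%:MP.
Proof.
move=> a0; rewrite -(sqr_sqrtr a0) rmorphXn /=.
by apply: (@PS_mono (2 * 0)) => //; apply/PS_sqr/deg_leC.
Qed.

(** Variables are moved one at a time from [m2] to [m1]. The lemma serves both to peel off one
    variable and to cut a monomial into two halves. *)
Lemma mnm_split (m : 'X_{1..N}) (k : nat) : (k <= mdeg m)%N ->
  exists m1 m2, [/\ m = (m1 + m2)%MM, mdeg m1 = k & mdeg m2 = (mdeg m - k)%N].
Proof.
elim: k => [|k IH] km; first by exists 0%MM, m; rewrite add0m mdeg0 subn0.
have [m1 [m2 [mE m1k m2k]]] := IH (ltnW km).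
have [i i0] : exists i, m2 i != 0%N.
  apply/existsP; rewrite -negb_forall; apply/negP => /forallP h.
  move: m2k; rewrite mdegE big1 => [|i _]; first by lia.
  by apply/eqP.
have ile : (U_(i) <= m2)%MM by rewrite lep1mP.
exists (m1 + U_(i))%MM, (m2 - U_(i))%MM; split.
- by rewrite mE -addmA [(U_(i) + _)%MM]addmC submK.
- by rewrite mdegD mdeg1 m1k addn1.
- by have := congr1 mdeg (submK ile); rewrite mdegD mdeg1; lia.
Qed.

(** * The constant 1 as an order unit when the variables are bounded *)

Section Bounded.
Variable (B : R).
Hypotheses (B0 : 0 <= B) (hB : forall i, proves_ge c I w 2 B%:MP ('X_i ^+ 2)).

Lemma PS_monomial_sqr (k : nat) (m : 'X_{1..N}) : mdeg m = k ->
  PS c I w (2 * k) ((B ^+ k)%:MP - 'X_[m] ^+ 2).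
Proof.
elim: k m => [|k IH] m mk.
  move/eqP: mk; rewrite mdeg_eq0 => /eqP ->.
  by rewrite mpolyX0 expr1n expr0 subrr -(mpolyC0); apply: PS_const.
have [|m1 [m2 [mE m1k m2k]]] := @mnm_split m 1; first by rewrite mk.
rewrite {}mE.
have /mdeg1P[i /eqP ->] : mdeg m1 == 1%N by rewrite m1k.
(* Telescoping through [B *: 'X_[m2] ^+ 2] uses the induction hypothesis once and the bound on
   ['X_i] once. *)
have -> : (B ^+ k.+1)%:MP - 'X_[(U_(i) + m2)] ^+ 2 =
    B *: ((B ^+ k)%:MP - 'X_[m2] ^+ 2) + (B%:MP - 'X_i ^+ 2) * 'X_[m2] ^+ 2
    :> {mpoly R[N]}.
  rewrite mpolyXD -mul_mpolyC exprS mpolyCM; ring.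
have m2k' : mdeg m2 = k by lia.
apply: PS_add.
  by apply: PS_scale => //; apply: (@PS_mono (2 * k)); [lia|apply: IH].
have -> : (2 * k.+1 = 2 + 2 * k)%N by lia.
by apply: PS_mulsqr; [apply: deg_leX; rewrite m2k'|apply: hB].
Qed.

Lemma PS_term_bound (d : nat) (a : R) (m : 'X_{1..N}) : (mdeg m <= 2 * d)%N ->
  exists r : R, PS c I w (2 * d) (r%:MP - a *: 'X_[m]).
Proof.
(* With [mdeg m <= 2 * d], taking [minn d (mdeg m)] variables leaves at most [d] for [m2]. *)
move=> md; have [|m1 [m2 [mE m1k m2k]]] := @mnm_split m (minn d (mdeg m)).
  exact: geq_minr.
have d1 : (mdeg m1 <= d)%N by rewrite m1k geq_minl.
have d2 : (mdeg m2 <= d)%N by lia.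
have b1 : PS c I w (2 * d) ((B ^+ mdeg m1)%:MP - 'X_[m1] ^+ 2).
  by apply: PS_mono (PS_monomial_sqr erefl); lia.
have b2 : PS c I w (2 * d) ((B ^+ mdeg m2)%:MP - 'X_[m2] ^+ 2).
  by apply: PS_mono (PS_monomial_sqr erefl); lia.
rewrite {}mE.
(* Half of the square of [a *: 'X_[m1] - 'X_[m2]] bounds the term; keeping [a] inside the square
   avoids a case split on its sign. *)
exists (2^-1 * (a ^+ 2 * B ^+ mdeg m1 + B ^+ mdeg m2)).
have -> : (2^-1 * (a ^+ 2 * B ^+ mdeg m1 + B ^+ mdeg m2))%:MP - a *: 'X_[m1 + m2]
  = 2^-1 *: (a ^+ 2 *: ((B ^+ mdeg m1)%:MP - 'X_[m1] ^+ 2)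
             + ((B ^+ mdeg m2)%:MP - 'X_[m2] ^+ 2)
             + (a *: 'X_[m1] - 'X_[m2]) ^+ 2) :> {mpoly R[N]}.
  have h2 : (2^-1)%:MP * 2 = 1 :> {mpoly R[N]}.
    by rewrite -(rmorph_nat (@mpolyC N R)) -mpolyCM mulVf ?pnatr_eq0.
  rewrite mpolyXD -[a *: (_ * _)]scale1r -!mul_mpolyC mpolyC1 -h2.
  rewrite !(mpolyCM, mpolyCD) (rmorphXn (@mpolyC N R)) /=.
  by ring.
apply: PS_scale; first by rewrite invr_ge0.
apply: PS_add; first by apply: PS_add => //; apply: PS_scale => //; apply: sqr_ge0.
apply: PS_sqr; apply: deg_leD.
  rewrite -mul_mpolyC -[d in X in (_ <= X)%E]add0n PoszD.
  by apply: deg_leM; [apply: deg_leC|apply: deg_leX].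
rewrite -scaleN1r -mul_mpolyC -[d in X in (_ <= X)%E]add0n PoszD.
by apply: deg_leM; [apply: deg_leC|apply: deg_leX].
Qed.

Lemma PS_order_unit (d : nat) p : (deg p <= (2 * d)%N%:Z%:E)%E ->
  exists r : R, PS c I w (2 * d) (r%:MP - p).
Proof.
rewrite deg_leE => hp; rewrite [p]mpolyE big_seq.
apply: (big_rec (fun q => exists r : R, PS c I w (2 * d) (r%:MP - q))).
  by exists 0; rewrite subr0; apply: PS_const.
move=> m q mp [r hr].
have [|s hs] := @PS_term_bound d p@_m m.
  (* Each monomial in the support has degree below [msize p], which is at most [2 * d + 1]. *)
  by have := msize_mdeg_lt mp; lia.
exists (s + r); rewrite mpolyCD opprD addrACA; exact: PS_add.
Qed.

End Bounded.
End Cone.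

(** * Duality between proofs and pseudo-expectations *)

Theorem corollary6 (R : realType) (n d : nat) (hd : (0 < d)%N)
    (Q : constraints R (n + n))
    (c : {set 'I_(nineq Q)} + 'I_(neq Q) -> nat) (hc : cutoff c)
    (w : nat) (hw : (0 < w)%N)
    (I : set {mpoly R[n + n]}) (hI : is_ideal I)
    (p : polyle R (n + n) (2 * d)%N)
    (hbound : exists2 B : R, 0 <= B &
       forall i : 'I_(n + n), proves_ge c I w 2 B%:MP ('X_i ^+ 2)) :
  ereal_sup [set r%:E | r in [set r : R | proves_ge c I w (2 * d)%N p r%:MP]]
  = ereal_inf [set (E p)%:E | E in pseudo_expectations c I w (2 * d)%N]
  /\
  (pseudo_expectations c I w (2 * d)%N !=set0 ->
   exists2 E, pseudo_expectations c I w (2 * d)%N E &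
     (E p)%:E
     = ereal_inf [set (E' p)%:E | E' in pseudo_expectations c I w (2 * d)%N]).
Proof.
have [B B0 hB] := hbound.
pose C : set (polyle R (n + n) (2 * d)) := fun v => PS c I w (2 * d) v.
have hC : is_cone C.
  split; first by rewrite /C /= -mpolyC0; apply: PS_const.
  - by move=> v v'; apply: PS_add.
  - by move=> a v; apply: PS_scale.
have Cunit v : exists r : R, C (r *: polyle1 R (n + n) (2 * d) - v).
  have [r hr] := PS_order_unit hI B0 hB (polyle_deg v); exists r.
  by rewrite /C /= -mul_mpolyC mulr1.
have := order_unit_duality p hC Cunit.
(* The two infima agree by unfolding; only the constant [r], written as a multiple of 1, has to be
   identified. *)
suff -> : [set r : R | C (p - r *: polyle1 R (n + n) (2 * d))] =
    [set r : R | proves_ge c I w (2 * d) p r%:MP] by [].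
by apply/funext => r; rewrite /C /proves_ge /= -[in LHS]mul_mpolyC mulr1.
Qed.
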